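(* For every composite number $n$, the distance characteristic polynomial of the strong power graph $\mathcal{P}_s(\mathbb{Z}_n)$ is $$\Theta(\mathcal{P}_s(\mathbb{Z}_n),x)=(x+1)^{n-3}\Big(x^3+(3-n)x^2+(3-2n-3\phi(n))x-\phi(n)^2-\phi(n)(4-n)-n+1\Big),$$ where $\phi$ is Euler's totient function.
   Context: For a finite group $G$ of order $n$, the strong power graph $\mathcal{P}_s(G)$ is the simple graph with vertex set $G$ in which two distinct vertices $x,y$ are adjacent if and only if $x^{n_1}=y^{n_2}$ for some positive integers $n_1,n_2<n$. $\mathbb{Z}_n=\{0,1,\ldots,n-1\}$ is the cyclic group of order $n$ under addition modulo $n$ (so $x^{n_1}$ means $n_1x$). For a connected graph $\Gamma$ with vertices $v_1,\dots,v_n$, the distance matrix $D(\Gamma)$ is the $n\times n$ matrix whose $(i,j)$ entry is the graph distance between $v_i$ and $v_j$, and $\Theta(\Gamma,x)=\det(xI-D(\Gamma))$ is its distance characteristic polynomial. *)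

(* Defs.v *)
From HB Require Import structures.
From mathcomp Require Import all_boot all_order all_algebra all_fingroup.

Set Implicit Arguments.
Unset Strict Implicit.
Unset Printing Implicit Defensive.

Definition composite (n : nat) : bool := (1 < n) && ~~ prime n.

Record sgraph : Type := SGraph {
  vertex : finType;
  adj : rel vertex;
  adj_sym : symmetric adj;
  adj_irrefl : irreflexive adj
}.

Section Distance.

Variable g : sgraph.
Implicit Types x y : vertex g.

Definition walk_of_length (k : nat) x y : bool :=
  [exists p : k.-tuple (vertex g), path (@adj g) x p && (last x p == y)].

(* A shortest walk has fewer than #|vertex g| edges, so the search below the  *)
(* order of the graph is exhaustive; if y cannot be reached from x the value  *)
(* is the junk value #|vertex g| (see gdist_walk and gdist_min).              *)
Definition gdist x y : nat :=
  find (fun k => walk_of_length k x y) (iota 0 #|vertex g|).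

Lemma walk_of_lengthP x y (p : seq (vertex g)) :
  path (@adj g) x p -> last x p = y -> walk_of_length (size p) x y.
Proof.
move=> pth lst; apply/existsP; exists (in_tuple p).
by rewrite /= pth lst eqxx.
Qed.

Lemma gdist_walk x y : connect (@adj g) x y -> walk_of_length (gdist x y) x y.
Proof.
case/connectP=> p0 /shortenP[p pth unq _] ->; set z := last x p.
have szp : size p < #|vertex g| by rewrite -[_.+1]/(size (x :: p)) -(card_uniqP unq) max_card.
have hasw : has (fun k => walk_of_length k x z) (iota 0 #|vertex g|).
  apply/hasP; exists (size p); first by rewrite mem_iota.
  exact: walk_of_lengthP pth _.
have := nth_find 0 hasw; rewrite -/(gdist x z) nth_iota //.
by have := hasw; rewrite has_find size_iota.
Qed.

Lemma gdist_min x y (k : nat) : walk_of_length k x y -> gdist x y <= k.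
Proof.
move=> w; case: (ltnP k (gdist x y)) => // ltk.
have := before_find 0 ltk; rewrite nth_iota ?add0n ?w //.
by apply: leq_trans ltk _; rewrite /gdist -[leqRHS](size_iota 0) find_size.
Qed.

(* The vertices are listed in the order of enum; the characteristic           *)
(* polynomial does not depend on that order.                                  *)
Definition distance_matrix : 'M[int]_#|vertex g| :=
  (\matrix_(i, j) (gdist (enum_val i) (enum_val j))%:Z)%R.

Definition distance_char_poly : {poly int} := char_poly distance_matrix.

End Distance.

Section StrongPowerGraph.

Variable gT : finGroupType.
Implicit Types x y : gT.

Definition strong_power_adj : rel gT := fun x y =>
  (x != y) &&
  [exists n1 : 'I_#|gT|, exists n2 : 'I_#|gT|,
     [&& 0 < n1, 0 < n2 & (x ^+ n1 == y ^+ n2)%g]].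

Lemma strong_power_adj_sym : symmetric strong_power_adj.
Proof.
move=> x y; rewrite /strong_power_adj eq_sym; congr (_ && _).
by apply/idP/idP => /existsP[a /existsP[b /and3P[a0 b0 /eqP e]]];
  apply/existsP; exists b; apply/existsP; exists a; rewrite a0 b0 e eqxx.
Qed.

Lemma strong_power_adj_irrefl : irreflexive strong_power_adj.
Proof. by move=> x; rewrite /strong_power_adj eqxx. Qed.

Definition strong_power_graph : sgraph :=
  SGraph strong_power_adj_sym strong_power_adj_irrefl.

End StrongPowerGraph.

(* Main.v *)
Require Import Defs.
From HB Require Import structures.
From mathcomp Require Import all_boot all_order all_algebra all_fingroup.
From mathcomp Require Import ring.
Import GRing.Theory.
Local Open Scope ring_scope.

(** For composite [n] the strong power graph of [Z_n] is the complete graph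
    minus the edges joining [0] to the generators, and [0] and a generator have
    a common neighbour.  Writing [e] and [u] for the indicator vectors of [0]
    and of the generators, the distance matrix is therefore
    [J - I + e u^T + u e^T], so that [x I - D = (x + 1) I - P Q] with [P] of
    width 3.  Sylvester's identity reduces the determinant to that of the
    3 x 3 matrix [(x + 1) I - Q P]. *)

(** Both sides compute [y ^+ k * \det A] for the block matrix [A]. Clearing the block [Q] by column
    operations gives [\det A = \det (y%:M - P *m Q)]. Clearing it by row operations first scales the
    lower rows by [y], which costs [y ^+ k] and avoids any division by [y]. *)
Lemma det_sylvester (R : comNzRingType) (m k : nat) (y : R)
    (P : 'M[R]_(m, k)) (Q : 'M[R]_(k, m)) :
  y ^+ k * \det (y%:M - P *m Q) = y ^+ m * \det (y%:M - Q *m P).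
Proof.
pose A := block_mx y%:M P Q 1%:M.
have detA : \det A = \det (y%:M - P *m Q).
  have := det_mulmx A (block_mx 1%:M 0 (- Q) 1%:M).
  rewrite mulmx_block !mulmx1 !mulmx0 mul1mx mulmxN addrN !add0r.
  by rewrite det_ublock det_lblock !det1 !mulr1 => ->.
have := det_mulmx (block_mx 1%:M 0 (- Q) y%:M) A.
rewrite mulmx_block !mul1mx !mul0mx !addr0 mulmx1 !mulNmx.
rewrite -scalar_mxC addNr det_ublock det_lblock det1 mul1r !det_scalar detA.
by rewrite addrC => ->.
Qed.

Lemma det_mx33 (R : comNzRingType) (f : nat -> nat -> R) :
  \det (\matrix_(i < 3, j < 3) f i j) =
    f 0 0 * (f 1 1 * f 2 2 - f 1 2 * f 2 1)
  - f 0 1 * (f 1 0 * f 2 2 - f 1 2 * f 2 0)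
  + f 0 2 * (f 1 0 * f 2 1 - f 1 1 * f 2 0).
Proof.
rewrite !(expand_det_row _ ord0) !big_ord_recl !big_ord0 /cofactor.
rewrite !(expand_det_row _ ord0) !big_ord_recl !big_ord0 /cofactor !det_mx11 !mxE /=.
rewrite /bump /=.
ring.
Qed.

Section GraphDistance.

Variable g : sgraph.
Implicit Types x y z : vertex g.

Lemma walk_of_length0 x y : walk_of_length 0 x y = (x == y).
Proof.
by apply/existsP/idP => [[p]|xy]; [rewrite tuple0|exists [tuple]].
Qed.

Lemma walk_of_length1 x y : walk_of_length 1 x y = adj x y.
Proof.
apply/existsP/idP => [[p]|xy]; last by exists [tuple y]; rewrite /= xy eqxx.
by case/tupleP: p => z p; rewrite tuple0 /= andbT => /andP[xz /eqP <-].
Qed.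

Lemma gdistxx x : gdist x x = 0%N.
Proof.
by apply/eqP; rewrite -leqn0; apply: gdist_min; rewrite walk_of_length0.
Qed.

Lemma gdist_adj x y : adj x y -> gdist x y = 1%N.
Proof.
move=> xy; have := @gdist_walk g x y (connect1 xy).
have := @gdist_min g x y 1; rewrite walk_of_length1 => /(_ xy).
case: (gdist x y) => [|[|//]] // _; rewrite walk_of_length0 => /eqP eqxy.
by move: xy; rewrite eqxy adj_irrefl.
Qed.

Lemma gdist_common_neighbour x y z :
  x != y -> ~~ adj x y -> adj x z -> adj z y -> gdist x y = 2%N.
Proof.
move=> neqxy nxy xz zy.
have := @gdist_walk g x y (connect_trans (connect1 xz) (connect1 zy)).
have pxy : path (@adj g) x [:: z; y] by rewrite /= xz zy.
have := gdist_min (@walk_of_lengthP g x y _ pxy erefl).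
case: (gdist x y) => [|[|[|//]]] //= _.
  by rewrite walk_of_length0 (negPf neqxy).
by rewrite walk_of_length1 (negPf nxy).
Qed.

End GraphDistance.

Section CyclicStrongPowerGraph.

Variable m : nat.
Local Notation n := m.+2.
Implicit Types x y : 'I_n.

Lemma Zp_expg_eq0 x k : ((x ^+ k)%g == 0) = (n %| x * k)%N.
Proof. by rewrite Zp_expg -val_eqE. Qed.

(** A residue coprime to [n] has additive order exactly [n]; the strict bound on exponents in the
    adjacency relation is thus what separates [0] from the generators. *)
Lemma coprime_expg_eq0 x k :
  coprime n x -> (0 < k < n)%N -> ((x ^+ k)%g == 0) = false.
Proof.
move=> cx /andP[k0 kn]; rewrite Zp_expg_eq0 Gauss_dvdr //.
by apply/negP => /(dvdn_leq k0); rewrite leqNgt kn.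
Qed.

Lemma noncoprime_expg0 x :
  ~~ coprime n x -> exists2 k : 'I_n, (0 < k)%N & (x ^+ k)%g = 0.
Proof.
move=> ncx; have g1 : (1 < gcdn n x)%N.
  by rewrite ltn_neqAle eq_sym ncx gcdn_gt0.
(* The exponent is the order of [x]; it is below [n] because the gcd exceeds 1. *)
have kn : (n %/ gcdn n x < n)%N by rewrite ltn_Pdiv.
exists (Ordinal kn) => /=.
  by rewrite divn_gt0 ?gcdn_gt0 // dvdn_leq ?dvdn_gcdl.
apply/eqP; rewrite Zp_expg_eq0 /=.
by rewrite gcdnC muln_divCA_gcd dvdn_mulr.
Qed.

Lemma coprime_expg_surj x y :
  coprime n x -> y != 0 -> exists2 k : 'I_n, (0 < k)%N & (x ^+ k)%g = y.
Proof.
move=> cx y0; have ux : (x : 'Z_n) \is a GRing.unit.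
  by rewrite -[x]natr_Zp unitZpE.
(* Taking a power is multiplying in the ring ['Z_n], so the exponent is the quotient of [y] by the
   unit [x], nonzero because [y] is. *)
exists ((x : 'Z_n)^-1 * y).
  rewrite lt0n; apply: contraNneq y0 => k0.
  have k0' : (x : 'Z_n)^-1 * y = 0 by apply: val_inj.
  by rewrite -(mulVKr ux y) k0' mulr0.
by rewrite FinRing.zmodXgE -mulr_natr natr_Zp mulVKr.
Qed.

(** Two non-generators have a common power [0]. A generator has every nonzero [y] among its
    admissible powers, and meets it at [y] itself with exponent 1 on the other side. But [0] has
    only itself as a power, which no generator reaches. *)
Lemma strong_power_adjE x y :
  strong_power_adj x y =
    [&& x != y, ~~ ((x == 0) && coprime n y) & ~~ ((y == 0) && coprime n x)].
Proof.
have adjI (a b : 'I_n) (k l : 'I_n) : a != b -> (0 < k)%N -> (0 < l)%N ->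
    (a ^+ k)%g = (b ^+ l)%g -> strong_power_adj a b.
  move=> nab k0 l0 e; rewrite /strong_power_adj nab /=.
  apply/existsP; exists (cast_ord (esym (card_ord n)) k).
  apply/existsP; exists (cast_ord (esym (card_ord n)) l).
  by rewrite /= k0 l0 e eqxx.
have nadj (b : 'I_n) : coprime n b -> strong_power_adj (0 : 'I_n) b = false.
  move=> cb; apply/negbTE; rewrite /strong_power_adj negb_and orbC.
  apply/orP; left; apply/negP.
  move=> /existsP[k /existsP[l /and3P[_ l0]]].
  rewrite FinRing.zmodXgE mul0rn eq_sym coprime_expg_eq0 // l0.
  by case: (l) => i /=; rewrite card_ord.
have [->|nxy] /= := eqVneq x y; first exact: strong_power_adj_irrefl.
have [cx|ncx] := boolP (coprime n x); have [cy|ncy] := boolP (coprime n y);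
  rewrite ?andbT ?andbF /=.
- have nz (z : 'I_n) : coprime n z -> z != 0.
    by apply: contraTneq => ->; rewrite /coprime gcdn0.
  rewrite !nz //; have [k k0 e] := coprime_expg_surj x y cx (nz _ cy).
  by apply: (adjI x y k 1).
- have [->|y0] := eqVneq y 0; first by rewrite strong_power_adj_sym nadj.
  have [k k0 e] := coprime_expg_surj x y cx y0.
  by apply: (adjI x y k 1).
- have [->|x0] := eqVneq x 0; first by rewrite nadj.
  have [k k0 e] := coprime_expg_surj y x cy x0.
  by apply: (adjI x y 1 k).
- have [k k0 e] := noncoprime_expg0 x ncx.
  have [l l0 f] := noncoprime_expg0 y ncy.
  by apply: (adjI x y k l) => //; rewrite e f.
Qed.

Lemma gdist_strong_power x y : composite n ->
  @gdist (strong_power_graph 'I_n) x y =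
    ((x != y) + ((x == 0%R) && coprime n y) + ((y == 0%R) && coprime n x))%N.
Proof.
move=> /andP[_ npr].
have nc0 : coprime n (0%R : 'I_n) = false by rewrite /coprime gcdn0.
have [->|nxy] := eqVneq x y.
  by rewrite gdistxx; case: eqVneq => // ->; rewrite nc0.
have pn : (pdiv n < n)%N.
  rewrite ltn_neqAle pdiv_leq // andbT; apply: contraNneq npr => <-.
  exact: pdiv_prime.
(* The least prime divisor of the composite [n] is a nonzero non-generator, hence a common neighbour
   of [0] and every generator. *)
pose z : 'I_n := Ordinal pn.
have ncz : coprime n z = false.
  rewrite /coprime gcdnC (gcdn_idPl (pdiv_dvd n)) /=.
  by apply/negbTE; rewrite neq_ltn prime_gt1 ?orbT ?pdiv_prime.
have z0 : z != 0 by rewrite -val_eqE /= -lt0n pdiv_gt0.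
have adj0z : strong_power_adj (0 : 'I_n) z.
  by rewrite strong_power_adjE eq_sym z0 ncz nc0 !andbF.
have adjzc (b : 'I_n) : coprime n b -> strong_power_adj z b.
  move=> cb; rewrite strong_power_adjE (negPf z0) cb andbT /=.
  have -> /= : z != b by apply: contraTneq cb => <-; rewrite ncz.
  by rewrite ncz andbF.
have [/andP[/eqP x0 cy]|h1] := boolP ((x == 0) && coprime n y).
  have -> : (y == 0) && coprime n x = false by rewrite x0 nc0 andbF.
  apply: (@gdist_common_neighbour (strong_power_graph 'I_n) x y z).
  - exact: nxy.
  - by rewrite /= strong_power_adjE x0 eqxx cy andbF.
  - by rewrite /= x0.
  - exact: adjzc.
have [/andP[/eqP y0 cx]|h2] := boolP ((y == 0) && coprime n x).
  apply: (@gdist_common_neighbour (strong_power_graph 'I_n) x y z).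
  - exact: nxy.
  - by rewrite /= strong_power_adjE y0 eqxx cx !andbF.
  - by rewrite /= strong_power_adj_sym adjzc.
  - by rewrite /= y0 strong_power_adj_sym.
by apply: gdist_adj; rewrite /= strong_power_adjE nxy h1 h2.
Qed.

End CyclicStrongPowerGraph.

Lemma sum_coprime_ord (n : nat) : (\sum_(x < n) coprime n x)%N = totient n.
Proof. by rewrite totient_count_coprime big_mkord. Qed.

Theorem theorem2p2 (n : nat) (hn : composite n) :
  distance_char_poly (strong_power_graph 'Z_n) =
  ('X + 1) ^+ (n - 3) *
  ('X^3 + (3 - n%:Z) *: 'X^2
   + (3 - 2 * n%:Z - 3 * (totient n)%:Z) *: 'X
   + (- (totient n)%:Z ^+ 2 - (totient n)%:Z * (4 - n%:Z) - n%:Z + 1)%:P).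
Proof.
case: n hn => [|[|m]] // hn.
(* This ensures that the natural subtraction [n - 3] is not truncated. *)
have n3 : (3 <= m.+2)%N by case: m hn.
set n := m.+2 in hn n3 *.
set phi := totient n.
pose one (_ : 'I_n) : {poly int} := 1.
pose e (x : 'I_n) : {poly int} := (x == 0)%:R.
pose u (x : 'I_n) : {poly int} := (coprime n x)%:R.
(* The lists for [P] and [Q] swap [e] and [u], so that [P *m Q] is the symmetric sum
   [J + e u^T + u e^T]. *)
pose pf (k : nat) := nth one [:: one; e; u] k.
pose qf (k : nat) := nth one [:: one; u; e] k.
pose P : 'M[{poly int}]_(#|'I_n|, 3) := \matrix_(i, k) pf k (enum_val i).
pose Q : 'M[{poly int}]_(3, #|'I_n|) := \matrix_(k, i) qf k (enum_val i).
have charE : char_poly_mx (distance_matrix (strong_power_graph 'I_n))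
    = ('X + 1)%:M - P *m Q.
  apply/matrixP => i j; rewrite !mxE !big_ord_recl big_ord0 !mxE /=.
  rewrite gdist_strong_power // (inj_eq enum_val_inj).
  rewrite -natz raddfMn /= !natrD -!mulnb !natrM.
  rewrite -[bump 0 0]/1%N -[bump 0 1]/2%N /pf /qf /= /one /e /u.
  by case: (i == j) => /=; ring.
have sum_one : \sum_x one x = (n%:Z)%:P.
  by rewrite sumr_const card_ord -polyC1 -polyCMn natz.
have sum_e (f : 'I_n -> {poly int}) : \sum_x e x * f x = f 0.
  rewrite (bigD1 0) //= /e eqxx mul1r big1 ?addr0 // => x /negPf ->.
  by rewrite mul0r.
have sum_u : \sum_x u x = (phi%:Z)%:P.
  by rewrite -natr_sum sum_coprime_ord -polyC1 -polyCMn natz.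
have e0 : e 0 = 1 by rewrite /e eqxx.
have u0 : u 0 = 0 by rewrite /u /coprime gcdn0.
have uu x : u x * u x = u x by rewrite /u; case: coprime; rewrite ?mulr1 ?mulr0.
pose G (i j : nat) := \sum_x qf i x * pf j x.
pose H (i j : nat) := ('X + 1) *+ (i == j) - G i j.
have QPE : ('X + 1)%:M - Q *m P =
    \matrix_(i < 3, j < 3) H i j.
  apply/matrixP => i j; rewrite !mxE; congr (_ - _).
  rewrite /G (big_enum_val (fun x => qf i x * pf j x)) /=.
  by apply: eq_bigr => k _; rewrite !mxE.
have y3 : ('X + 1 : {poly int}) ^+ 3 != 0.
  by rewrite expf_neq0 // monic_neq0 // -polyC1 monicXaddC.
(* The factor [('X + 1) ^+ 3] is the one Sylvester's identity asks for; it turns the right-hand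
   power into [('X + 1) ^+ n], and both sides then share that factor. *)
apply: (mulfI y3).
rewrite /distance_char_poly /char_poly charE det_sylvester QPE card_ord.
rewrite mulrA -exprD subnKC // det_mx33 /H.
(* The entries of [Q *m P] are inner products of indicator vectors; its rows are [(n, 1, phi)],
   [(phi, 0, phi)] and [(1, 1, 0)]. *)
have one_e : \sum_x one x * e x = 1.
  by under eq_bigr do rewrite mulrC; rewrite sum_e.
have one_u : \sum_x one x * u x = phi%:Z%:P.
  by under eq_bigr do rewrite mul1r.
have u_one : \sum_x u x * one x = phi%:Z%:P.
  by under eq_bigr do rewrite mulr1.
have u_e : \sum_x u x * e x = 0.
  by under eq_bigr do rewrite mulrC; rewrite sum_e.
have u_u : \sum_x u x * u x = phi%:Z%:P by rewrite (eq_bigr u).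
have one_one : \sum_x one x * one x = n%:Z%:P.
  by under eq_bigr do rewrite mulr1.
rewrite /G /qf /pf /= one_one one_e one_u u_one u_e u_u !sum_e e0 u0.
rewrite /one -!mul_polyC.
move: n%:Z phi%:Z => a b; congr (_ * _); ring.
Qed.
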